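(* For any real number $s$ with $0\le s\le 1$, there exists a compact set $E\subset\mathbb{R}$ such that the Hausdorff dimension of $E$ satisfies $\dim_H E=s$, the Fourier dimension of $E$ satisfies $\dim_F E=0$, and $E$ contains arbitrarily long arithmetic progressions.
   Context: Arithmetic progressions: for $k\ge 3$, a set $A\subset\mathbb{R}$ is a $k$-term arithmetic progression with gap $\delta>0$ if there exists $t>0$ such that $A=\{t+\delta x : x=0,1,\dots,k-1\}$. A set contains arbitrarily long arithmetic progressions if for every $k\ge 3$ it contains a $k$-term arithmetic progression (the gap may depend on $k$). $\dim_H$ denotes the usual Hausdorff dimension. Fourier dimension: for $A\subset\mathbb{R}$, $$\dim_F A=\sup\Big\{\beta\in[0,1] : \text{there exist a (Borel) probability measure } \mu \text{ on } A \text{ and a constant } C>0 \text{ such that } |\widehat{\mu}(\xi)|\le C|\xi|^{-\beta/2} \text{ for all } \xi\in\mathbb{R}\setminus\{0\}\Big\},$$ where $\widehat{\mu}(\xi)=\int e^{-2\pi i\xi x}\,d\mu(x)$ is the Fourier transform of $\mu$. *)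

(* Defs.v *)
From HB Require Import structures.
From mathcomp Require Import all_boot all_order all_algebra.
From mathcomp Require Import complex.
From mathcomp Require Import all_classical all_reals all_analysis.
Set Implicit Arguments.
Unset Strict Implicit.
Unset Printing Implicit Defensive.
Import Order.TTheory GRing.Theory Num.Theory.
Import numFieldNormedType.Exports.
Local Open Scope classical_set_scope.
Local Open Scope ring_scope.

Definition is_AP (R : realType) (k : nat) (delta : R) (A : set R) : Prop :=
  0 < delta /\
  exists2 t : R, 0 < t & A = [set t + delta * x%:R | x in [set x | (x < k)%N]].

Definition contains_arbitrarily_long_APs (R : realType) (E : set R) : Prop :=
  forall k : nat, (3 <= k)%N ->
    exists (delta : R) (A : set R), is_AP k delta A /\ A `<=` E.

(* The diameter of the empty set is -oo here; [diam_pow] never uses it. *)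
Definition diam (R : realType) (U : set R) : \bar R :=
  ereal_sup [set `|p.1 - p.2|%:E | p in U `*` U].

(* diam(U)^s with the usual conventions of Hausdorff measures: the empty set
   has weight 0, also for s = 0, and [poweR] gives 0^0 = 1, so that the
   0-dimensional Hausdorff measure is the counting measure. *)
Definition diam_pow (R : realType) (s : R) (U : set R) : \bar R :=
  if U == set0 then 0%E else (diam U `^ s)%E.

Definition hausdorff_premeasure (R : realType) (s delta : R) (A : set R) :
    \bar R :=
  ereal_inf [set (\sum_(0 <= i <oo) diam_pow s (U i))%E |
    U in [set U : nat -> set R |
           A `<=` \bigcup_i U i /\ forall i, (diam (U i) <= delta%:E)%E]].

(* The supremum over delta > 0 is the limit as delta tends to 0, since
   [hausdorff_premeasure s delta A] is nonincreasing in delta. *)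
Definition hausdorff_measure (R : realType) (s : R) (A : set R) : \bar R :=
  ereal_sup [set hausdorff_premeasure s delta A |
              delta in [set delta : R | 0 < delta]].

Definition hausdorff_dim (R : realType) (A : set R) : \bar R :=
  ereal_inf [set s%:E |
              s in [set s : R | 0 <= s /\ hausdorff_measure s A = 0%E]].

Definition expi (R : realType) (t : R) : R[i] := Complex (cos t) (sin t).

Definition Cintegral (R : realType) (mu : probability (measurableTypeR R) R)
    (f : R -> R[i]) : R[i] :=
  Complex (Rintegral mu setT (fun x => complex.Re (f x)))
          (Rintegral mu setT (fun x => complex.Im (f x))).

Definition fourier_transform (R : realType)
    (mu : probability (measurableTypeR R) R) (xi : R) : R[i] :=
  Cintegral mu (fun x => expi (- (2 * pi * xi * x))).

(* A probability measure "on A" is a Borel probability measure on R for which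
   the complement of A is negligible, that is, contained in a Borel null set;
   for Borel A this says mu A = 1. *)
Definition fourier_decay (R : realType) (A : set R) (beta : R) : Prop :=
  exists (mu : probability (measurableTypeR R) R) (C : R),
    [/\ mu.-negligible (~` A),
        0 < C &
        forall xi : R, xi != 0 ->
          ComplexField.Normc.normc (fourier_transform mu xi) <=
            C * `|xi| `^ (- (beta / 2))].

Definition fourier_dim (R : realType) (A : set R) : R :=
  sup [set beta : R | 0 <= beta <= 1 /\ fourier_decay A beta].

(* Main.v *)
Require Import Defs.
From HB Require Import structures.
From mathcomp Require Import all_boot all_order all_algebra.
From mathcomp Require Import complex.
From mathcomp Require Import all_classical all_reals all_analysis.
From mathcomp Require Import zify ring lra.
Set Implicit Arguments.
Unset Strict Implicit.
Unset Printing Implicit Defensive.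
Import Order.TTheory GRing.Theory Num.Theory.
Import numFieldNormedType.Exports.
Local Open Scope classical_set_scope.
Local Open Scope ring_scope.

(** The witness is the set [E] of reals in [0, 1] whose binary digits vanish
    outside a set [S] of positions.  It is always compact, and separate features
    of [S] control its dimensions and its progressions.

    Write N(n) for the number of free positions below n.  The first n digits
    take 2 ^ N(n) values, so [E] is covered by that many intervals of length
    2 ^ -n, which bounds the Hausdorff dimension by liminf N(n) / n
    ([digit_set_measure0]).  Conversely, deleting the positions outside [S]
    from the digit sequences of [E] produces all of [0, 1[, and two points at distance at
    most 2 ^ -n have images at distance at most 3 * 2 ^ -N(n) ([coded_dist]):
    the deletion is Hoelder of every exponent below the lower density of [S].
    Since countably many sets covering [0, 1[ have total length at least 1,
    this is the matching lower bound ([digit_set_cover_ge]); the Lebesgue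
    measure of the target plays the role of the Cantor measure on [E].

    If three consecutive positions starting at n are outside [S], the
    fractional part of 2 ^ n * x lies in [0, 1/8] for every x in [E], so that
    the Fourier transform at 2 ^ n of any probability measure on [E] has real
    part at least cos (pi / 4).  When this occurs for infinitely many n, no
    such transform tends to 0 ([fourier_decay_le0]).

    If k consecutive positions starting at n are in [S], then every multiple
    j * 2 ^ -(n + k) with j < 2 ^ k is in [E], an arithmetic progression
    ([digit_set_APs]).

    It remains to choose [S] of lower density s with long runs and infinitely
    many gaps: the K-th block consists of about s * K ^ 2 + K free positions
    followed by about (1 - s) * K ^ 2 + K forced ones.  The quadratic terms
    dominate and fix the density, even when s is 0 or 1, while the linear terms
    provide the runs and the gaps. *)

(** * Binary prefixes supported on a set of positions *)

(** The integers whose [n]-digit binary expansion vanishes outside [S], digit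
    number [0] being the most significant one.  They are enumerated as a list
    because both their finiteness and their number matter. *)
Fixpoint prefixes (S : pred nat) (n : nat) : seq nat :=
  if n is n'.+1 then
    if S n' then [seq p.*2 | p <- prefixes S n']
                   ++ [seq p.*2.+1 | p <- prefixes S n']
    else [seq p.*2 | p <- prefixes S n']
  else [:: 0%N].

Definition nfree (S : pred nat) (n : nat) : nat := (\sum_(i < n) S i)%N.

Lemma nfreeS (S : pred nat) n : nfree S n.+1 = (nfree S n + S n)%N.
Proof. by rewrite /nfree big_ord_recr. Qed.

Lemma size_prefixes (S : pred nat) n : size (prefixes S n) = (2 ^ nfree S n)%N.
Proof.
elim: n => [|n IH]; first by rewrite /nfree big_ord0.
rewrite nfreeS /=; case: (S n).
  by rewrite size_cat !size_map IH addn1 expnS mul2n addnn.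
by rewrite size_map IH addn0.
Qed.

Lemma prefixesS (S : pred nat) n p (b : bool) :
  (b ==> S n) -> ((p.*2 + b)%N \in prefixes S n.+1) = (p \in prefixes S n).
Proof.
have odd_even x (s : seq nat) : (x.*2.+1 \in [seq y.*2 | y <- s]) = false.
  by apply/negbTE/mapP => -[y _ xy]; lia.
have even_odd x (s : seq nat) : (x.*2 \in [seq y.*2.+1 | y <- s]) = false.
  by apply/negbTE/mapP => -[y _ xy]; lia.
have double_in x (s : seq nat) : (x.*2 \in [seq y.*2 | y <- s]) = (x \in s).
  by apply: mem_map => u v; lia.
have doubleS_in x (s : seq nat) :
    (x.*2.+1 \in [seq y.*2.+1 | y <- s]) = (x \in s).
  by apply: mem_map => u v; lia.
rewrite /=; case: b => /= [->|_].
  by rewrite addn1 mem_cat odd_even doubleS_in.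
rewrite addn0; case: (S n); last by rewrite double_in.
by rewrite mem_cat double_in even_odd orbF.
Qed.

Lemma prefixesS_zero (S : pred nat) n p :
  ~~ S n -> p \in prefixes S n.+1 -> exists2 q, q \in prefixes S n & p = q.*2.
Proof. by rewrite /= => /negbTE-> /mapP[q qS ->]; exists q. Qed.

Lemma half_prefix (S : pred nat) n p :
  p \in prefixes S n.+1 -> p./2 \in prefixes S n.
Proof.
rewrite /=; case: (S n); last by case/mapP=> q qS ->; rewrite doubleK.
rewrite mem_cat => /orP[] /mapP[q qS ->]; first by rewrite doubleK.
by rewrite /= uphalf_double.
Qed.

Lemma divn_prefix (S : pred nat) n i p :
  p \in prefixes S (n + i) -> (p %/ 2 ^ i)%N \in prefixes S n.
Proof.
elim: i p => [|i IH] p; first by rewrite addn0 divn1.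
by rewrite addnS => /half_prefix/IH; rewrite -divn2 -divnMA -expnS.
Qed.

Lemma muln_prefix (S : pred nat) n i p :
  p \in prefixes S n -> (p * 2 ^ i)%N \in prefixes S (n + i).
Proof.
elim: i => [|i IH] pS; first by rewrite muln1 addn0.
rewrite addnS expnSr mulnA muln2 -[_.*2]addn0.
by rewrite (@prefixesS _ _ _ false)// IH.
Qed.

Lemma prefixes_run (S : pred nat) n l j :
  (forall i, (i < l)%N -> S (n + i)%N) -> (j < 2 ^ l)%N ->
  j \in prefixes S (n + l).
Proof.
elim: l j => [|l IH] j Sl jl.
  have -> : j = (0 * 2 ^ n)%N by move: jl; rewrite expn0; lia.
  by rewrite addn0 -[X in prefixes S X]add0n muln_prefix.
rewrite addnS -(odd_double_half j) addnC prefixesS; last first.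
  by rewrite Sl// implybT.
apply: IH => [i il|]; first by apply: Sl; rewrite ltnS ltnW.
by move: jl; rewrite expnS; lia.
Qed.

(** * Expansion and compression of digit sequences *)

(** The first [n] digits of the point obtained by writing the bits of [a] at the
    positions of [S] and zeros elsewhere, read as an integer.  The bits of [a]
    outside [S] are ignored rather than required to vanish, so that every [a]
    is admissible. *)
Fixpoint expanded (S : pred nat) (a : nat -> bool) (n : nat) : nat :=
  if n is n'.+1 then ((expanded S a n').*2 + (S n' && a n'))%N else 0%N.

(** The same digits once the positions outside [S] have been deleted: a number
    of [nfree S n] digits. *)
Fixpoint compressed (S : pred nat) (a : nat -> bool) (n : nat) : nat :=
  if n is n'.+1 then
    if S n' then ((compressed S a n').*2 + a n')%N else compressed S a n'
  else 0%N.

Lemma expanded_prefix (S : pred nat) a n : expanded S a n \in prefixes S n.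
Proof.
elim: n => [//|n IH].
by rewrite [expanded _ _ _]/= prefixesS//; apply/implyP => /andP[].
Qed.

(** Deleting the forced zeros is strictly increasing on the integers supported
    on [S], and takes all values below [2 ^ nfree S n]: it preserves the rank,
    hence cannot increase distances.  Comparing prefixes as integers copes with
    the carries that make close reals differ at an early digit. *)
Lemma compressed_dist (S : pred nat) a b n :
  (`|compressed S a n - compressed S b n| <=
     `|expanded S a n - expanded S b n|)%N.
Proof.
(* The induction needs the signed form: digits appended to two distinct
   prefixes must not be able to reverse their order. *)
suff: (expanded S a n = expanded S b n /\ compressed S a n = compressed S b n)
   \/ (compressed S a n < compressed S b n /\
       compressed S b n + expanded S a n <= compressed S a n + expanded S b n)%N
   \/ (compressed S b n < compressed S a n /\
       compressed S a n + expanded S b n <= compressed S b n + expanded S a n)%N.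
  lia.
elim: n => [|n IH] /=; first by left.
by move: IH; case: (S n) => /=; case: (a n); case: (b n) => /=; lia.
Qed.

(** * The set of reals whose free digits are prescribed *)

Definition cylinder (R : realType) (n p : nat) : set R :=
  [set x | p%:R <= 2 ^+ n * x <= p.+1%:R].
Arguments cylinder : clear implicits.

(** The points with an expansion supported on [S].  Closed cylinders are used,
    so that a dyadic point only needs one admissible description at each level;
    the set is then visibly closed, and no digit sequence has to be extracted
    from a point. *)
Definition digit_set (R : realType) (S : pred nat) : set R :=
  [set x | forall n, exists2 p, p \in prefixes S n & cylinder R n p x].
Arguments digit_set : clear implicits.

Lemma cylinder_itv (R : realType) n p :
  cylinder R n p = `[p%:R / 2 ^+ n, p.+1%:R / 2 ^+ n]%classic.
Proof.
apply/seteqP; split=> x; rewrite /cylinder /= in_itv /=;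
  by rewrite ler_pdivrMr ?exprn_gt0// ler_pdivlMr ?exprn_gt0// mulrC.
Qed.

Lemma digit_setE (R : realType) (S : pred nat) : digit_set R S =
  \bigcap_(n in setT) \big[setU/set0]_(p <- prefixes S n) cylinder R n p.
Proof.
apply/seteqP; split=> x Sx n => [_|].
  by have [p pS xp] := Sx n; rewrite -bigcup_seq; exists p.
by have := Sx n I; rewrite -bigcup_seq => -[p pS xp]; exists p.
Qed.

Lemma closed_digit_set (R : realType) (S : pred nat) : closed (digit_set R S).
Proof.
rewrite digit_setE; apply: closed_bigI => n _.
apply: closed_bigsetU => p _; rewrite cylinder_itv; exact: itv_closed.
Qed.

Lemma compact_digit_set (R : realType) (S : pred nat) :
  compact (digit_set R S).
Proof.
apply: subclosed_compact (@closed_digit_set R S) (@segment_compact R 0 1) _.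
move=> x /(_ 0%N)[p]; rewrite inE => /eqP->.
by rewrite /cylinder /= expr0 mul1r in_itv.
Qed.

Lemma cylinder_divn (R : realType) n i p (x : R) :
  cylinder R (n + i) p x -> cylinder R n (p %/ 2 ^ i) x.
Proof.
rewrite /cylinder /= exprD mulrAC => /andP[px xp].
have i0 : 0 < 2 ^+ i :> R by rewrite exprn_gt0.
have /andP[lo hi] : (p %/ 2 ^ i * 2 ^ i <= p < (p %/ 2 ^ i).+1 * 2 ^ i)%N.
  by rewrite leq_divM ltn_ceil// expn_gt0.
apply/andP; split; rewrite -(ler_pM2r i0) -[X in _%:R * X](natrX R 2 i) -natrM.
  by rewrite (le_trans _ px)// ler_nat.
by rewrite (le_trans xp)// ler_nat.
Qed.

(** Left endpoints of the cylinders belong to the digit set: their remaining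
    digits are all zero. *)
Lemma prefix_digit_set (R : realType) (S : pred nat) n p :
  p \in prefixes S n -> digit_set R S (p%:R / 2 ^+ n).
Proof.
have px : cylinder R n p (p%:R / 2 ^+ n).
  by rewrite /cylinder /= mulrC divfK ?expf_neq0// lexx ler_nat leqnSn.
move=> pS m; have [nm|mn] := leqP n m.
  rewrite -(subnKC nm); exists (p * 2 ^ (m - n))%N; first exact: muln_prefix.
  rewrite /cylinder /= exprD mulrAC mulrCA divff ?expf_neq0// mulr1.
  by rewrite -natrX -natrM lexx ler_nat leqnSn.
exists (p %/ 2 ^ (n - m))%N.
  by apply: divn_prefix; rewrite subnKC// ltnW.
by apply: cylinder_divn; rewrite subnKC// ltnW.
Qed.

Lemma expanded_divn (S : pred nat) a n i :
  (expanded S a (n + i) %/ 2 ^ i)%N = expanded S a n.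
Proof.
elim: i => [|i IH]; first by rewrite addn0 divn1.
rewrite addnS expnS divnMA -IH; congr (_ %/ _)%N.
by rewrite divn2 /= addnC half_bit_double.
Qed.

(** Nested cylinders share the supremum of their left endpoints. *)
Lemma cylinders_inter (R : realType) (S : pred nat) a :
  exists x, forall n, cylinder R n (expanded S a n) x.
Proof.
pose u n : R := (expanded S a n)%:R / 2 ^+ n.
pose v n : R := (expanded S a n).+1%:R / 2 ^+ n.
have cyl n i : cylinder R n (expanded S a n) (u (n + i)%N).
  rewrite -(expanded_divn S a n i); apply: cylinder_divn.
  by rewrite /cylinder /= mulrC divfK ?expf_neq0// lexx ler_nat leqnSn.
have uv m n : u m <= v n.
  have [nm|mn] := leqP n m.
    by have := cyl n (m - n)%N; rewrite subnKC// cylinder_itv /= in_itv => /andP[].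
  have : u m <= u n.
    by have := cyl m (n - m)%N;
      rewrite subnKC ?(ltnW mn)// cylinder_itv /= in_itv => /andP[].
  move=> /le_trans; apply; rewrite ler_pM2r ?invr_gt0 ?exprn_gt0//.
  by rewrite ler_nat.
exists (sup (range u)) => n; rewrite cylinder_itv /= in_itv /=.
apply/andP; split.
  apply: ub_le_sup; last by exists n.
  by exists (v n) => _ [m _ <-]; exact: uv.
apply: ge_sup; first by exists (u 0%N); exists 0%N.
by move=> _ [m _ <-]; exact: uv.
Qed.

(** * Comparing the digit set with the unit interval *)

(** The correspondence that deletes the digits at the positions outside [S].
    It is kept as a relation because a dyadic point may have two expansions. *)
Definition coded (R : realType) (S : pred nat) (x y : R) : Prop :=
  exists a, forall n, cylinder R n (expanded S a n) x /\
    cylinder R (nfree S n) (compressed S a n) y.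

Lemma truncn_double (R : realType) (z : R) : 0 <= z ->
  Num.truncn (2 * z) = (((Num.truncn z).*2) + odd (Num.truncn (2 * z)))%N.
Proof.
move=> z0; have z20 : 0 <= 2 * z by rewrite mulr_ge0.
have /andP[l1 h1] := truncn_itv z0; have /andP[l2 h2] := truncn_itv z20.
set p := Num.truncn z in l1 h1 *; set q := Num.truncn (2 * z) in l2 h2 *.
have h3 : 2 * z < (p.+1.*2)%:R by rewrite -mul2n natrM ltr_pM2l.
have l3 : (p.*2)%:R <= 2 * z by rewrite -mul2n natrM ler_pM2l.
have : (q < p.+1.*2)%N by rewrite -(ltr_nat R) (le_lt_trans l2).
have : (p.*2 < q.+1)%N by rewrite -(ltr_nat R) (le_lt_trans l3).
by rewrite -{3}(odd_double_half q); lia.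
Qed.

(** Place the binary digits of [y] at the positions of [S].  The value [1] is
    excluded because its expansion by truncation would start with the
    digit [1] before the binary point. *)
Lemma coded_surj (R : realType) (S : pred nat) (y : R) : 0 <= y < 1 ->
  exists2 x, digit_set R S x & coded S x y.
Proof.
case/andP=> y0 y1.
pose a n := odd (Num.truncn (2 ^+ nfree S n.+1 * y)).
have compE n : compressed S a n = Num.truncn (2 ^+ nfree S n * y).
  elim: n => [|n IH] /=.
    rewrite /nfree big_ord0 mul1r; apply/esym/eqP.
    by rewrite truncn_eq// y0.
  rewrite IH /a nfreeS; case: (S n); last by rewrite addn0.
  by rewrite addn1 exprS -mulrA -truncn_double// mulr_ge0// exprn_ge0.
have [x xP] := cylinders_inter R S a.
exists x.
  by move=> n; exists (expanded S a n) => //; exact: expanded_prefix.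
exists a => n; split; first exact: xP.
rewrite /cylinder /= compE.
by have /andP[-> /ltW] := @truncn_itv R (2 ^+ nfree S n * y)
  ltac:(by rewrite mulr_ge0// exprn_ge0).
Qed.

(** At level [n] the prefixes of [x] and [x'] differ by at most [2]: one for the
    distance of the points and one for their positions inside the cylinders.
    The compressed prefixes then differ by at most [2], and the points of
    their cylinders by at most [3] units. *)
Lemma coded_dist (R : realType) (S : pred nat) (x x' y y' : R) n :
  coded S x y -> coded S x' y' ->
  2 ^+ n * `|x - x'| <= 1 -> 2 ^+ nfree S n * `|y - y'| <= 3.
Proof.
move=> [a /(_ n)[xa ya]] [b /(_ n)[xb yb]].
have normE m (z : R) : 2 ^+ m * `|z| = `|2 ^+ m * z|.
  by rewrite normrM ger0_norm// exprn_ge0.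
rewrite !normE !mulrBr => xx'.
have {}xx' : (`|expanded S a n - expanded S b n| <= 2)%N.
  move: xa xb xx'; rewrite /cylinder /= -!natr1 ler_norml.
  move=> /andP[? ?] /andP[? ?] /andP[? ?].
  have : (expanded S a n <= expanded S b n + 2)%N.
    by rewrite -(ler_nat R) natrD; lra.
  have : (expanded S b n <= expanded S a n + 2)%N.
    by rewrite -(ler_nat R) natrD; lra.
  lia.
have {xx'} := leq_trans (compressed_dist S a b n) xx'.
move: (compressed S a n) (compressed S b n) ya yb => p q.
rewrite /cylinder /= -!natr1 ler_norml => /andP[? ?] /andP[? ?] pq.
have : (p <= q + 2)%N by lia.
have : (q <= p + 2)%N by lia.
by rewrite -2!(ler_nat R) !natrD => ? ?; apply/andP; split; lra.
Qed.

(** * Hausdorff dimension *)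

Lemma expr2_gt (R : realType) (z : R) : exists n, z < 2 ^+ n.
Proof.
exists (Num.truncn z).+1; apply: (lt_trans (truncnS_gt z)).
by rewrite -natrX ltr_nat ltn_expl.
Qed.

Lemma dyadic_scale (R : realType) (d : R) : 0 < d <= 1 ->
  exists n, 2 ^+ n * d <= 1 < 2 ^+ n.+1 * d.
Proof.
case/andP=> d0 d1; have exn : exists n, 1 < 2 ^+ n * d.
  by have [n dn] := expr2_gt d^-1; exists n; rewrite -ltr_pdivrMr// mul1r.
case: (ex_minnP exn) => -[|n] nd minn; first by move: nd; rewrite mul1r ltNge d1.
exists n; rewrite nd andbT leNgt; apply/negP => /minn; by rewrite ltnn.
Qed.

(** A modulus of continuity known at the dyadic scales, with gain
    [N n >= t * n - c], is a Hoelder bound of exponent [t].  The case [d = 0] is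
    included with the convention that [0 `^ 0] is [1]: this covers pieces of
    diameter zero, and the exponent [t = 0]. *)
Lemma dyadic_holder (R : realType) (N : nat -> nat) (t c d u : R) :
  0 <= t -> 0 <= u -> 0 <= d <= 1 ->
  (forall n, t * n%:R - c <= (N n)%:R) ->
  (forall n, 2 ^+ n * d <= 1 -> 2 ^+ N n * u <= 3) ->
  u <= 3 * 2 `^ (c + t) * d `^ t.
Proof.
move=> t0 u0 /andP[d0 d1] Nlow dist.
have {Nlow dist} dist n : 2 ^+ n * d <= 1 -> 2 `^ (t * n%:R - c) * u <= 3.
  move=> /dist; apply: le_trans; apply: ler_wpM2r => //.
  by rewrite -powR_mulrn// ler_powR// ler1n.
have pow2_gt0 x : 0 < 2 `^ x :> R by rewrite powR_gt0.
have [d_eq0|d_neq0] := eqVneq d 0; last first.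
  have [|n /andP[dn nd]] := @dyadic_scale _ d.
    by rewrite lt0r d_neq0 d0.
  rewrite -(ler_pM2l (pow2_gt0 (t * n%:R - c))) (le_trans (dist n dn))//.
  rewrite mulrCA -mulrA ler_peMr// mulrA -powRD ?pnatr_eq0 ?implybT//.
  have -> : c + t + (t * n%:R - c) = n.+1%:R * t by rewrite -natr1; ring.
  rewrite powRrM powR_mulrn// -powRM ?exprn_ge0//.
  have one_t : 1 `^ t = 1 :> R by rewrite powR1.
  rewrite -[leLHS]one_t; apply: ge0_ler_powR => //;
    rewrite ?nnegrE ?ler01//; last exact: ltW.
  by rewrite mulr_ge0// exprn_ge0.
move: dist; rewrite {}d_eq0 => dist {d0 d1}.
have {}dist n : 2 `^ (t * n%:R - c) * u <= 3 by rewrite dist// mulr0.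
(* For [d = 0] and [t > 0] every scale is available, which forces [u = 0]. *)
have [t_eq0|t_neq0] := eqVneq t 0.
  have := dist 0%N; rewrite t_eq0 mul0r sub0r powRr0 mulr1 addr0 powRN.
  by rewrite mulrC ler_pdivrMr.
rewrite (powR0 t_neq0) mulr0 leNgt; apply/negP => u_gt0.
have [m um] := expr2_gt (3 / u).
have t_gt0 : 0 < t by rewrite lt0r t_neq0.
have := dist (Num.truncn ((m%:R + c) / t)).+1.
apply/negP; rewrite -ltNge -ltr_pdivrMr// (lt_le_trans um)//.
rewrite -powR_mulrn// ler_powR ?ler1n// lerBrDr mulrC.
by rewrite -ler_pdivrMr// ltW// truncnS_gt.
Qed.

(** ** Lower bound for the digit set *)

Lemma coded_holder (R : realType) (S : pred nat) (t c x x' y y' : R) :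
  0 <= t -> (forall n, t * n%:R - c <= (nfree S n)%:R) ->
  coded S x y -> coded S x' y' -> `|x - x'| <= 1 ->
  `|y - y'| <= 3 * 2 `^ (c + t) * `|x - x'| `^ t.
Proof.
move=> t0 Nlow xy xy' x1.
apply: (@dyadic_holder _ (nfree S)) => //; first by rewrite normr_ge0.
by move=> n; exact: coded_dist.
Qed.

Lemma diam_ub (R : realType) (U : set R) x y :
  U x -> U y -> (`|x - y|%:E <= diam U)%E.
Proof. by move=> Ux Uy; apply: ereal_sup_ubound; exists (x, y). Qed.

Lemma diam_fin (R : realType) (U : set R) (e : R) x :
  U x -> (diam U <= e%:E)%E -> exists2 d : R, 0 <= d <= e & diam U = d%:E.
Proof.
move=> Ux; have := diam_ub Ux Ux; rewrite subrr normr0.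
by case: (diam U) => [d| |]//; rewrite !lee_fin => d0 de; exists d; rewrite ?d0.
Qed.

Lemma diam_pow_ge0 (R : realType) (t : R) (U : set R) : (0 <= diam_pow t U)%E.
Proof. by rewrite /diam_pow; case: ifP => // _; exact: poweR_ge0. Qed.

(** A cover of the digit set is carried by [coded] to a cover of [0, 1[.  The
    image of a piece of diameter [d] lies within [K * d `^ t] of any of its
    points, hence in an interval of length [2 * K * d `^ t], and countable
    subadditivity of the Lebesgue measure bounds the sum of these lengths
    below by [1]. *)
Lemma digit_set_cover_ge (R : realType) (S : pred nat) (t c : R)
    (U : nat -> set R) :
  0 <= t -> (forall n, t * n%:R - c <= (nfree S n)%:R) ->
  digit_set R S `<=` \bigcup_i U i -> (forall i, (diam (U i) <= 1)%E) ->
  (1 <= (6 * 2 `^ (c + t))%:E * \sum_(0 <= i <oo) diam_pow t (U i))%E.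
Proof.
move=> t0 Nlow SU diamU; set K := 3 * 2 `^ (c + t).
have K0 : 0 <= K by rewrite mulr_ge0 ?powR_ge0.
pose Y i := [set y | exists2 x, U i x & coded S x y].
have VP i : exists V : set R, [/\ measurable V, Y i `<=` V &
    (lebesgue_measure V <= (2 * K)%:E * diam_pow t (U i))%E].
  have [[y0 [x0 Ux0 xy0]]|/set0P/negP/negPn/eqP Y0] := pselect (Y i !=set0);
    last first.
    exists set0; split=> //; first by rewrite Y0.
    by rewrite measure0 mule_ge0 ?lee_fin ?mulr_ge0// diam_pow_ge0.
  have [d /andP[d0 d1] Ud] := diam_fin Ux0 (diamU i).
  pose r := K * d `^ t.
  have r0 : 0 <= r by rewrite mulr_ge0 ?powR_ge0.
  exists `[y0 - r, y0 + r]%classic; split=> //.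
    move=> y [x Ux xy]; rewrite /= in_itv /= -ler_distl distrC.
    have xd : `|x0 - x| <= d by rewrite -lee_fin -Ud diam_ub.
    rewrite (le_trans (coded_holder t0 Nlow xy0 xy (le_trans xd d1)))//.
    by rewrite ler_wpM2l// ge0_ler_powR ?nnegrE.
  have -> : diam_pow t (U i) = (d `^ t)%:E.
    rewrite /diam_pow Ud poweR_EFin ifF//; apply/negbTE/set0P.
    by exists x0.
  rewrite lebesgue_measure_itv /= lte_fin; case: ifP => _; last first.
    by rewrite mule_ge0 ?lee_fin ?mulr_ge0 ?powR_ge0.
  rewrite -?EFinN -?EFinD -?EFinM lee_fin /r; lra.
have /choice[V VP'] := VP.
have -> : 6 * 2 `^ (c + t) = 2 * K by rewrite /K; ring.
rewrite -nneseriesZl; last by move=> i _; exact: diam_pow_ge0.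
have itv01 : lebesgue_measure (`[0, 1[%classic : set R) = 1%E.
  by rewrite lebesgue_measure_itv /= lte_fin ltr01 oppr0 adde0.
rewrite -itv01.
have cov : `[0, 1[%classic `<=` \bigcup_i V i.
  move=> y; rewrite /= in_itv /= => /(coded_surj S)[x /SU[i _ Ux] xy].
  by exists i => //; have [_ YV _] := VP' i; apply: YV; exists x.
have mV i : measurable (V i) by have [] := VP' i.
have := measure_sigma_subadditive (@lebesgue_measure R) mV (measurable_itv _) cov.
move/le_trans; apply.
by apply: lee_nneseries => // i _; have [] := VP' i.
Qed.

Lemma digit_set_measure_neq0 (R : realType) (S : pred nat) (t c : R) :
  0 <= t -> (forall n, t * n%:R - c <= (nfree S n)%:R) ->
  hausdorff_measure t (digit_set R S) <> 0%E.
Proof.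
move=> t0 Nlow H0.
set L := 6 * 2 `^ (c + t).
have L0 : 0 < L by rewrite mulr_gt0 ?powR_gt0.
have : ((L^-1)%:E <= hausdorff_measure t (digit_set R S))%E.
  apply: (@le_trans _ _ (hausdorff_premeasure t 1 (digit_set R S))).
    apply: le_ereal_inf_tmp => _ [U [SU diamU] <-].
    have := digit_set_cover_ge t0 Nlow SU diamU; rewrite -/L => L1.
    by rewrite -[leLHS]mule1 lee_pdivrMl.
  by apply: ereal_sup_ubound; exists 1 => /=; rewrite ?ltr01.
by rewrite H0 leNgt lte_fin invr_gt0 L0.
Qed.

(** ** Upper bound for the digit set *)

Lemma hausdorff_premeasure_ge0 (R : realType) (t e : R) (A : set R) :
  (0 <= hausdorff_premeasure t e A)%E.
Proof.
apply: le_ereal_inf_tmp => _ [U _ <-].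
by apply: nneseries_ge0 => i _ _; exact: diam_pow_ge0.
Qed.

Lemma diam_cylinder (R : realType) n p :
  (diam (cylinder R n p) <= (2 ^- n)%:E)%E.
Proof.
apply: ge_ereal_sup => _ [[x y] [/= cx cy] <-]; rewrite lee_fin /=.
rewrite -[2 ^- n]mul1r ler_pdivlMr ?exprn_gt0//.
rewrite -[X in _ * X]ger0_norm ?exprn_ge0// -normrM mulrC mulrBr.
move: cx cy; rewrite /cylinder /= -natr1 ler_norml.
by move=> /andP[? ?] /andP[? ?]; apply/andP; split; lra.
Qed.

Lemma cylinder_neq0 (R : realType) n p : cylinder R n p != set0.
Proof.
apply/set0P; exists (p%:R / 2 ^+ n); rewrite /cylinder /=.
by rewrite mulrC divfK ?expf_neq0// lexx ler_nat leqnSn.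
Qed.

Lemma diam_pow_cylinder (R : realType) (t : R) n p : 0 <= t ->
  (diam_pow t (cylinder R n p) <= ((2 ^- n) `^ t)%:E)%E.
Proof.
move=> t0; have /set0P[x cx] := cylinder_neq0 R n p.
have [d /andP[d0 dn] Ud] := diam_fin cx (diam_cylinder R n p).
rewrite /diam_pow (negbTE (cylinder_neq0 R n p)) Ud poweR_EFin lee_fin.
by rewrite ge0_ler_powR// nnegrE// invr_ge0 exprn_ge0.
Qed.

(** The cover by all cylinders of level [n], completed with empty sets. *)
Lemma digit_set_premeasure_le (R : realType) (S : pred nat) (t e : R) n :
  0 <= t -> 2 ^- n <= e ->
  (hausdorff_premeasure t e (digit_set R S) <=
     (2 ^+ nfree S n * (2 ^- n) `^ t)%:E)%E.
Proof.
move=> t0 ne; set G := prefixes S n.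
pose U i := if (i < size G)%N then cylinder R n (nth 0%N G i) else set0.
apply: (@le_trans _ _ (\sum_(0 <= i <oo) diam_pow t (U i))%E).
  apply: ereal_inf_lbound; exists U => //; split=> [x /(_ n)[p pG xp]|i].
    exists (index p G) => //.
    by rewrite /U index_mem pG nth_index.
  rewrite /U; case: ifP => _.
    by rewrite (le_trans (diam_cylinder _ _ _))// lee_fin.
  rewrite /diam [X in ereal_sup X](_ : _ = set0) ?ereal_sup0 ?leNye//.
  by apply/seteqP; split=> // _ [p [[]]].
rewrite (nneseries_split 0 (size G)); last by move=> *; exact: diam_pow_ge0.
rewrite add0n eseries0 ?adde0; last first.
  by move=> i Gi _; rewrite /U ltnNge Gi /= /diam_pow eqxx.
have -> : 2 ^+ nfree S n * (2 ^- n) `^ t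
    = \sum_(0 <= i < size G) (2 ^- n) `^ t :> R.
  by rewrite big_const_nat subn0 iter_addr_0 size_prefixes -[RHS]mulr_natl natrX.
rewrite -sumEFin big_nat_cond [leRHS]big_nat_cond; apply: lee_sum => i.
by rewrite andbT /= => iG; rewrite /U iG diam_pow_cylinder.
Qed.

(** At the levels where the bound holds, the cover by cylinders has weight at
    most [2 `^ (c - (t - t') * n)]. *)
Lemma digit_set_measure0 (R : realType) (S : pred nat) (t t' c : R) :
  0 <= t' < t ->
  (forall m, exists2 n, (m <= n)%N & (nfree S n)%:R <= t' * n%:R + c) ->
  hausdorff_measure t (digit_set R S) = 0%E.
Proof.
move=> /andP[t'0 t't] Nup; have t0 : 0 <= t by lra.
apply/eqP; rewrite eq_le; apply/andP; split; last first.
  apply: (le_trans (hausdorff_premeasure_ge0 t 1 (digit_set R S))).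
  by apply: ereal_sup_ubound; exists 1 => /=; rewrite ?ltr01.
apply: ge_ereal_sup => _ [e /= e0 <-].
apply/lee_addgt0Pr => eps eps0; rewrite add0e.
have [m1 em1] := expr2_gt e^-1.
have [m2 em2] := expr2_gt (2 `^ c / eps).
pose m3 := (Num.truncn (m2%:R / (t - t'))).+1.
have [n nm nup] := Nup (maxn m1 m3).
have pow_gt0 k : 0 < 2 ^+ k :> R by rewrite exprn_gt0.
apply: (le_trans (@digit_set_premeasure_le _ S t e n t0 _)).
  have e1n : e^-1 <= 2 ^+ n.
    rewrite (le_trans (ltW em1))// -!natrX ler_nat leq_exp2l//.
    by rewrite (leq_trans _ nm)// leq_maxl.
  by rewrite -[e]invrK lef_pV2 ?posrE ?invr_gt0 ?pow_gt0.
rewrite lee_fin -powR_invn// -powRrM -powR_mulrn// -powRD ?pnatr_eq0 ?implybT//.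
have /(ler_powR (ler1n R 2)) : (nfree S n)%:R + (- n%:R) * t <= c - m2%:R.
  have : m2%:R / (t - t') <= n%:R.
    rewrite (le_trans (ltW (truncnS_gt _)))// ler_nat (leq_trans _ nm)//.
    exact: leq_maxr.
  by rewrite ler_pdivrMr ?subr_gt0//; lra.
move=> /le_trans; apply.
rewrite powRD ?pnatr_eq0 ?implybT// powRN powR_mulrn//.
by rewrite ler_pdivrMr// mulrC -ler_pdivrMr// ltW.
Qed.

Lemma hausdorff_dim_digit_set (R : realType) (S : pred nat) (s : R) : 0 <= s ->
  (forall t, 0 <= t < s ->
    exists c, forall n, t * n%:R - c <= (nfree S n)%:R) ->
  (forall t, s < t -> exists c, forall m,
    exists2 n, (m <= n)%N & (nfree S n)%:R <= t * n%:R + c) ->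
  hausdorff_dim (digit_set R S) = s%:E.
Proof.
move=> s0 Nlow Nup; apply/eqP; rewrite eq_le; apply/andP; split.
  apply/lee_addgt0Pr => e e0; rewrite -EFinD.
  have [|c Nc] := Nup (s + e / 2); first by lra.
  apply: ereal_inf_lbound; exists (s + e) => //; split; first by lra.
  by apply: (@digit_set_measure0 _ _ _ (s + e / 2) c) => //; lra.
apply: le_ereal_inf_tmp => _ [t [t0 Ht] <-]; rewrite lee_fin leNgt.
apply/negP => ts; have [|c Nc] := Nlow t; first by rewrite t0.
exact: digit_set_measure_neq0 t0 Nc Ht.
Qed.

(** * Fourier dimension *)

(** After three forced zeros at position [n], the number [2 ^+ n * x] exceeds an
    integer by at most [1 / 8]. *)
Lemma cos_digit_set (R : realType) (S : pred nat) n (x : R) :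
  (forall i, (i < 3)%N -> ~~ S (n + i)%N) -> digit_set R S x ->
  cos (pi / 4) <= cos (- (2 * pi * 2 ^+ n * x)).
Proof.
move=> Sn /(_ (n + 3)%N)[p]; rewrite !addnS addn0.
have S0 : ~~ S n by rewrite -[n]addn0 Sn.
have S1 : ~~ S n.+1 by rewrite -addn1 Sn.
have S2 : ~~ S n.+2 by rewrite -addn2 Sn.
case/(prefixesS_zero S2) => p2 /(prefixesS_zero S1)[p1].
move=> /(prefixesS_zero S0)[q _ ->] -> ->; rewrite /cylinder /= -natr1 !exprS.
rewrite -!mul2n !natrM => /andP[lo hi].
pose r := 2 ^+ n * x - q%:R.
have r0 : 0 <= r by rewrite /r; lra.
have r1 : 8 * r <= 1 by rewrite /r; lra.
have -> : cos (- (2 * pi * 2 ^+ n * x)) = cos (2 * pi * r).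
  rewrite cosN -(periodicn (@cosD2pi R) q (2 * pi * r)).
  by congr cos; rewrite /r; ring.
have pi0 := pi_gt0 R.
have pr : 0 <= pi * r by rewrite mulr_ge0// ltW.
have pr1 : pi * (8 * r) <= pi * 1 by rewrite ler_wpM2l// ltW.
by rewrite leNgt ltr_cos -?leNgt ?in_itv /=; [lra| |]; apply/andP; split; lra.
Qed.

Lemma integral_digit_set (R : realType) (S : pred nat) n
    (mu : probability (measurableTypeR R) R) :
  (forall i, (i < 3)%N -> ~~ S (n + i)%N) ->
  mu.-negligible (~` digit_set R S) ->
  cos (pi / 4) <= \int[mu]_x cos (- (2 * pi * 2 ^+ n * x)).
Proof.
move=> Sn muS; set f := fun x : R => cos (- (2 * pi * 2 ^+ n * x)).
have mf : measurable_fun [set: measurableTypeR R] f.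
  apply: measurable_realfun.continuous_measurable_fun => x.
  apply: continuous_comp; last exact: continuous_cos.
  by apply: continuousN; apply: continuousM; [exact: cvg_cst|exact: cvg_id].
have mS : measurable (digit_set R S : set (measurableTypeR R)).
  by apply: (@measurable_realfun.closed_measurable R); exact: closed_digit_set.
have muS0 : mu (~` digit_set R S) = 0%E.
  by apply/negligibleP => //; exact: measurableC.
have muS1 : mu (digit_set R S) = 1%E.
  by have := probability_setC mu (measurableC mS); rewrite setCK muS0 sube0.
have intf : mu.-integrable setT (EFin \o f).
  apply: measurable_bounded_integrable => //.
    by rewrite (le_lt_trans (probability_le1 mu measurableT))// ltry.
  by exists 1; split=> // M M1 x _; exact: le_trans (cos_max _) (ltW M1).
have -> : \int[mu]_x f x = \int[mu]_(x in digit_set R S) f x.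
  have := negligible_integral (measurableC mS)
    (@measurableT _ (measurableTypeR R)) intf muS0.
  by rewrite setTD setCK /Rintegral => ->.
have <- : \int[mu]_(x in digit_set R S) cos (pi / 4) = cos (pi / 4).
  by rewrite Rintegral_cst// [X in fine X]muS1 mulr1.
apply: le_Rintegral => //.
- exact: finite_measure_integrable_cst.
- by apply: (integrableS (@measurableT _ (measurableTypeR R)) mS
    (@subsetT _ _) intf).
- by move=> x; exact: cos_digit_set.
Qed.

(** Along the frequencies [2 ^+ n] given by the gaps, the real part of the
    transform stays above a fixed positive number. *)
Lemma fourier_decay_le0 (R : realType) (S : pred nat) (beta : R) :
  (forall m, exists2 n, (m <= n)%N & forall i, (i < 3)%N -> ~~ S (n + i)%N) ->
  fourier_decay (digit_set R S) beta -> beta <= 0.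
Proof.
move=> Szero [mu [C [muS C0 decay]]]; rewrite leNgt; apply/negP => beta0.
have c0 : 0 < cos (pi / 4) :> R.
  by have pi0 := pi_gt0 R; apply: cos_gt0_pihalf; apply/andP; split; lra.
have [m Cm] := expr2_gt (C / cos (pi / 4)).
have [n nm Sn] := Szero (Num.truncn (m%:R / (beta / 2))).+1.
have := decay (2 ^+ n) (lt0r_neq0 (exprn_gt0 _ (ltr0n _ 2))).
apply/negP; rewrite -ltNge.
have normc_ge (z : R[i]) : complex.Re z <= ComplexField.Normc.normc z.
  case: z => a b /=; rewrite (le_trans (ler_norm a))// -sqrtr_sqr.
  by rewrite ler_wsqrtr// lerDl sqr_ge0.
apply: lt_le_trans (normc_ge _); rewrite /=.
apply: lt_le_trans (integral_digit_set Sn muS).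
rewrite ger0_norm ?exprn_ge0// -powR_mulrn// -powRrM.
rewrite mulrN powRN -ltr_pdivlMr ?invr_gt0 ?powR_gt0// invrK.
rewrite mulrC -ltr_pdivrMr// (lt_le_trans Cm)//.
rewrite -powR_mulrn// ler_powR ?ler1n//.
rewrite -ler_pdivrMr ?divr_gt0// (le_trans (ltW (truncnS_gt _)))//.
by rewrite ler_nat.
Qed.

Lemma fourier_dim_digit_set (R : realType) (S : pred nat) :
  (forall m, exists2 n, (m <= n)%N & forall i, (i < 3)%N -> ~~ S (n + i)%N) ->
  fourier_dim (digit_set R S) = 0.
Proof.
move=> Szero; rewrite /fourier_dim; set B := [set beta | _].
have : B `<=` [set 0].
  move=> beta [/andP[beta0 _] /(fourier_decay_le0 Szero) beta_le0].
  by apply/eqP; rewrite eq_le beta_le0.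
by move=> /subset_set1[]->; rewrite ?sup0 ?sup1.
Qed.

(** * Arithmetic progressions *)

(** A run of [k] free positions gives [2 ^ k > k] equally spaced points; the
    point [0] is skipped since a progression has a positive first term. *)
Lemma digit_set_APs (R : realType) (S : pred nat) :
  (forall l, exists n, forall i, (i < l)%N -> S (n + i)%N) ->
  contains_arbitrarily_long_APs (digit_set R S).
Proof.
move=> Srun k _; have [n Sn] := Srun k.
have step0 : 0 < 2 ^- (n + k) :> R by rewrite invr_gt0 exprn_gt0.
exists (2 ^- (n + k)); exists [set 2 ^- (n + k) + 2 ^- (n + k) * x%:R
  | x in [set x | (x < k)%N]]; split.
  by split=> //; exists (2 ^- (n + k)).
move=> _ [x /= xk <-].
have -> : 2 ^- (n + k) + 2 ^- (n + k) * x%:R = x.+1%:R / 2 ^+ (n + k) :> R.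
  by rewrite -(natr1 x) mulrDl mul1r addrC mulrC.
apply: prefix_digit_set; apply: prefixes_run => //.
by rewrite (leq_ltn_trans xk)// ltn_expl.
Qed.

(** * Free positions in blocks *)

Definition block_start (m z : nat -> nat) (k : nat) : nat :=
  (\sum_(i < k) (m i + z i))%N.

(** Block number [k] has [m k] free positions followed by [z k] forced ones. *)
Definition block_free (m z : nat -> nat) : pred nat :=
  fun n => `[< exists2 k, (block_start m z k <= n)%N &
                          (n < block_start m z k + m k)%N >].

Section Blocks.
Variables m z : nat -> nat.
Hypothesis m_gt0 : forall k, (0 < m k)%N.

Let T := block_start m z.
Let S := block_free m z.
Let M k := (\sum_(i < k) m i)%N.

Let TS k : T k.+1 = (T k + (m k + z k))%N.
Proof. by rewrite /T /block_start big_ord_recr. Qed.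

Let MS k : M k.+1 = (M k + m k)%N.
Proof. by rewrite /M big_ord_recr. Qed.

Let T0 : T 0%N = 0%N. Proof. by rewrite /T /block_start big_ord0. Qed.

Let M0 : M 0%N = 0%N. Proof. by rewrite /M big_ord0. Qed.

Let leq_T : {homo T : i j / (i <= j)%N}.
Proof.
by apply: homo_leq => // [j i k|k]; [exact: leq_trans|rewrite TS leq_addr].
Qed.

Let leq_id_T k : (k <= T k)%N.
Proof.
by elim: k => // k IH; rewrite TS; have := m_gt0 k; move: IH; lia.
Qed.

Let block_of n : exists k j, (j < m k + z k)%N /\ n = (T k + j)%N.
Proof.
have exk : exists k, (n < T k)%N by exists n.+1; exact: leq_id_T.
case: (ex_minnP exk) => -[|k] nk mink; first by rewrite T0 in nk.
exists k, (n - T k)%N.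
have : (T k <= n)%N by rewrite leqNgt; apply/negP => /mink; rewrite ltnn.
by move: nk; rewrite TS; lia.
Qed.

Lemma block_freeE k j : (j < m k + z k)%N -> S (T k + j)%N = (j < m k)%N.
Proof.
move=> jL; apply/asboolP/idP => [ [i + +] | jm]; last first.
  by exists k; rewrite ?leq_addr// ltn_add2l.
rewrite -/(T i) => Ti iT; case: (ltngtP i k) => [ik|ki|ik].
- by have := leq_T ik; rewrite TS; lia.
- by have := leq_T ki; rewrite TS; lia.
- by rewrite ik in iT; rewrite ltn_add2l in iT.
Qed.

Lemma nfree_block k j :
  (j <= m k + z k)%N -> nfree S (T k + j)%N = (M k + minn j (m k))%N.
Proof.
elim: k j => [|k IHk] j.
  rewrite T0 M0 !add0n; elim: j => [|j IHj] jL.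
    by rewrite min0n /nfree big_ord0.
  have := block_freeE jL; rewrite T0 add0n => Sj.
  by rewrite nfreeS IHj ?(ltnW jL)// Sj; lia.
elim: j => [|j IHj] jL.
  by rewrite addn0 min0n addn0 TS MS IHk//; lia.
by rewrite addnS nfreeS IHj ?(ltnW jL)// block_freeE//; lia.
Qed.

(** Along a block, [nfree S n - t * n] first increases and then decreases, so
    that its minimum is at an end of the block, however long the block is; and
    its values at the ends are nondecreasing from [k0] on. *)
Lemma nfree_block_ge (R : realType) (t : R) k0 : 0 <= t <= 1 ->
  (forall k, (k0 <= k)%N -> t * (m k + z k)%:R <= (m k)%:R) ->
  forall n, t * n%:R - (T k0)%:R <= (nfree S n)%:R.
Proof.
move=> /andP[t0 t1] tm.
have tle p : t * p%:R <= p%:R by rewrite ler_piMl.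
have ends k : t * (T k)%:R - (T k0)%:R <= (M k)%:R.
  elim: k => [|k IH]; first by rewrite T0 mulr0 sub0r
    (le_trans _ (ler0n _ _))// oppr_le0.
  have [kk0|k0k] := leqP k0 k.
    by have := tm _ kk0; rewrite TS MS 2!natrD mulrDr; lra.
  have : t * (T k.+1)%:R <= (T k0)%:R.
    by rewrite (le_trans (tle _))// ler_nat leq_T.
  by move=> tT; rewrite (le_trans _ (ler0n _ _))//; lra.
move=> n; have [k [j [jL ->]]] := block_of n.
rewrite nfree_block ?(ltnW jL)// natrD mulrDr.
have [jm|/ltnW mj] := leqP j (m k).
  by rewrite natrD; have := ends k; have := tle j; lra.
have : t * j%:R <= t * (m k + z k)%:R by rewrite ler_wpM2l// ler_nat ltnW.
by have := ends k.+1; rewrite TS MS !natrD !mulrDr; lra.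
Qed.

Lemma nfree_block_le (R : realType) (t : R) k0 : 0 <= t ->
  (forall k, (k0 <= k)%N -> (m k)%:R <= t * (m k + z k)%:R) ->
  forall p, exists2 n, (p <= n)%N & (nfree S n)%:R <= t * n%:R + (M k0)%:R.
Proof.
move=> t0 mt p.
have ends i : (M (k0 + i)%N)%:R <= t * (T (k0 + i)%N)%:R + (M k0)%:R.
  elim: i => [|i IH]; first by rewrite addn0 lerDr mulr_ge0.
  by rewrite addnS TS MS 2!natrD mulrDr; have := mt _ (leq_addr i k0); lra.
exists (T (k0 + p)%N); first by rewrite (leq_trans _ (leq_id_T _))// leq_addl.
by rewrite -[T (k0 + p)%N]addn0 nfree_block// min0n !addn0.
Qed.

Lemma block_free_runs : (forall l, exists k, (l <= m k)%N) ->
  forall l, exists n, forall i, (i < l)%N -> S (n + i)%N.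
Proof.
move=> mlarge l; have [k lm] := mlarge l; exists (T k) => i il.
by rewrite block_freeE; lia.
Qed.

Lemma block_free_gaps l : (forall p, exists2 k, (p <= k)%N & (l <= z k)%N) ->
  forall p, exists2 n, (p <= n)%N & forall i, (i < l)%N -> ~~ S (n + i)%N.
Proof.
move=> zlarge p; have [k pk lz] := zlarge p.
exists (T k + m k)%N; first by have := leq_id_T k; lia.
by move=> i il; rewrite -addnA block_freeE; lia.
Qed.

End Blocks.

(** * Blocks of prescribed density *)

(** Used at [s] for the free positions of a block and at [1 - s] for the forced
    ones.  The index is shifted by one so that each block has some of both. *)
Definition density_block (R : realType) (s : R) (k : nat) : nat :=
  (Num.truncn (s * k.+1%:R ^+ 2) + k.+1)%N.

Lemma density_block_bounds (R : realType) (s : R) k : 0 <= s ->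
  s * k.+1%:R ^+ 2 - 1 + k.+1%:R <= (density_block s k)%:R
    <= s * k.+1%:R ^+ 2 + k.+1%:R.
Proof.
move=> s0; rewrite natrD !lerD2r.
have /truncn_itv : 0 <= s * k.+1%:R ^+ 2 by rewrite mulr_ge0// exprn_ge0.
by rewrite -[(Num.truncn _).+1%:R]natr1 => /andP[? ?]; apply/andP; split; lra.
Qed.

(** A block of parameter [K] has about [s * K ^+ 2 + K] free positions among
    [K ^+ 2 + 2 * K], and the gain [(s - t) * K ^+ 2] absorbs the linear terms
    as soon as [(s - t) * K >= 2]. *)
Lemma density_block_low (R : realType) (s t : R) k : 0 <= s <= 1 -> 0 <= t < s ->
  (Num.truncn (2 / (s - t)) <= k)%N ->
  t * (density_block s k + density_block (1 - s) k)%:R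
    <= (density_block s k)%:R.
Proof.
move=> /andP[s0 s1] /andP[t0 ts]; rewrite truncn_le_nat ltr_pdivrMr ?subr_gt0//.
have /andP[ml mh] := @density_block_bounds R s k s0.
have /andP[zl zh] := @density_block_bounds R (1 - s) k ltac:(by rewrite subr_ge0).
have K1 : 1 <= k.+1%:R :> R by rewrite ler1n.
rewrite natrD; move: k.+1%:R (density_block s k)%:R (density_block (1 - s) k)%:R
  ml mh zl zh K1 => K m z ml mh zl zh K1 tsK.
have : t * (m + z) <= t * (K ^+ 2 + 2 * K) by rewrite ler_wpM2l//; lra.
have : 2 * K <= (s - t) * K ^+ 2.
  by rewrite expr2 mulrA ler_wpM2r//; lra.
have : t * K <= 1 * K by rewrite ler_wpM2r//; lra.
by rewrite !mulrDr mulrBl; lra.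
Qed.

Lemma density_block_high (R : realType) (s t : R) k : 0 <= s <= 1 -> s < t ->
  (Num.truncn (2 / (t - s)) <= k)%N ->
  (density_block s k)%:R
    <= t * (density_block s k + density_block (1 - s) k)%:R.
Proof.
move=> /andP[s0 s1] st; rewrite truncn_le_nat ltr_pdivrMr ?subr_gt0//.
have /andP[ml mh] := @density_block_bounds R s k s0.
have /andP[zl zh] := @density_block_bounds R (1 - s) k ltac:(by rewrite subr_ge0).
have K1 : 1 <= k.+1%:R :> R by rewrite ler1n.
rewrite natrD; move: k.+1%:R (density_block s k)%:R (density_block (1 - s) k)%:R
  ml mh zl zh K1 => K m z ml mh zl zh K1 tsK.
have : t * K ^+ 2 <= t * (m + z) by rewrite ler_wpM2l//; lra.
have : 2 * K <= (t - s) * K ^+ 2.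
  by rewrite expr2 mulrA ler_wpM2r//; lra.
by rewrite !mulrDr mulrBl; lra.
Qed.

Theorem theorem2p3 (R : realType) (s : R) (hs : 0 <= s <= 1) :
  exists E : set R,
    [/\ compact E,
        hausdorff_dim E = s%:E,
        fourier_dim E = 0 &
        contains_arbitrarily_long_APs E].
Proof.
have /andP[s0 s1] := hs.
pose m := density_block s; pose z := density_block (1 - s).
have m_gt0 k : (0 < m k)%N by rewrite /m /density_block addnS.
exists (digit_set R (block_free m z)); split.
- exact: compact_digit_set.
- apply: hausdorff_dim_digit_set => // [t /andP[t0 ts]|t st].
    exists (block_start m z (Num.truncn (2 / (s - t))))%:R.
    apply: (nfree_block_ge m_gt0).
      by rewrite t0; lra.
    by move=> k kl; apply: density_block_low kl => //; rewrite t0.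
  exists (\sum_(i < Num.truncn (2 / (t - s))) m i)%N%:R.
  apply: (nfree_block_le m_gt0); first by lra.
  by move=> k kl; exact: density_block_high kl.
- apply: fourier_dim_digit_set; apply: block_free_gaps => // p.
  (* A block of index at least 3 ends with more than three forced positions. *)
  by exists (maxn p 3); rewrite ?leq_maxl// /z /density_block; lia.
- apply: digit_set_APs; apply: block_free_runs => // l.
  by exists l; rewrite /m /density_block; lia.
Qed.
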